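(* Consider the dynamic algorithm described in the context, run on any sequence of client insertions and deletions starting from the empty client set. Then, after each update has been processed (i.e., whenever the call to Fix-Clustering for that update terminates), the clustering $\mathcal{C}$ maintained by the algorithm is nice.
   Context: Facility location: finite facility set $F$, $m=|F|$, finite client set $D$, in a common metric space; $d_{ij}>0$ is the distance between facility $i$ and client $j$ (triangle inequality holds), $f_i\ge0$ the opening cost of facility $i$. Clusters: a cluster is a pair $C=(i,A)$ with $i\in F$, $A\subseteq D$, designated critical or satellite; satellite clusters have exactly one client. $cost(C)=\sum_{j\in A}d_{ij}$ if satellite, $f_i+\sum_{j\in A}d_{ij}$ if critical; $cost_{avg}(C)=cost(C)/|A|$. A clustering is a collection $\mathcal{C}$ of clusters in which every client of $D$ lies in exactly one cluster and, for each facility $i$ with $\mathcal{C}(i)$ (the clusters of $\mathcal{C}$ with facility $i$) nonempty, exactly one cluster of $\mathcal{C}(i)$ is critical; facility $i$ is open iff $\mathcal{C}(i)\ne\emptyset$ and each client is assigned to the facility of its cluster. Each $C\in\mathcal{C}$ has a level $\ell(C)\in\mathbb{Z}$; $\ell(j)=\ell(C)$ for clients $j$ of $C$. $\kappa^*_{ij}$ is the unique integer with $2^{\kappa^*_{ij}-4}\le d_{ij}<2^{\kappa^*_{ij}-3}$. A cluster $C=(i,A)$ (not necessarily in $\mathcal{C}$) is blocking at level $k$ w.r.t. $\mathcal{C}$ if (a) $cost_{avg}(C)<2^{k-3}$; (b) $\ell(j)>k\ge\kappa^*_{ij}$ for all $j\in A$; (c) if $C$ is satellite, some critical $C^*\in\mathcal{C}(i)$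 has $\ell(C^* )\le k$; if $C$ is critical, $k\le\ell(C')$ for all $C'\in\mathcal{C}(i)$. $\mathcal{C}$ is nice if (I1) $cost_{avg}(C)<2^{\ell(C)}$ for all $C\in\mathcal{C}$; (I2) for each $i$ with $\mathcal{C}(i)\neq\emptyset$ the critical cluster $C^*\in\mathcal{C}(i)$ has $\ell(C^* )\le\ell(C)$ for all $C\in\mathcal{C}(i)$; (I3) $\ell(j)\ge\kappa^*_{ij}$ for every $C=(i,A)\in\mathcal{C}$, $j\in A$; (I4) no cluster is blocking at any level w.r.t. $\mathcal{C}$. The algorithm: initially $D=\emptyset$ and $\mathcal{C}=\emptyset$. Deletion of $j$: remove $j$ from the client set of the cluster containing it, then call Fix-Clustering. Insertion of $j$: if no facility is open, pick $i$ minimizing $d_{ij}+f_i$ and create the critical cluster $(i,\{j\})$ at the level $k$ with $d_{ij}+f_i\in[2^{k-4},2^{k-3})$; otherwise pick any open facility $i$, let $C=(i,A)$ be its critical cluster, and if $\kappa^*_{ij}\le\ell(C)$ set $A\leftarrow A\cup\{j\}$, else add the satellite cluster $(i,\{j\})$ at level $\kappa^*_{ij}$; then call Fix-Clustering. Fix-Clustering: while (I4) or (I1) is violated: if (I4) is violated, find a cluster $C$ blocking at some level $k$ and call Fix-Blocking$(C,k)$; otherwise find a cluster $C$ violating (I1) and call Fix-Level$(C)$. Fix-Blocking$(C=(i,A),k)$: add $C$ to $\mathcal{C}$ with $\ell(C)=k$ and remove every $j\in A$ from the cluster it previously belonged to; if $C$ is critical and $C'=(i,A')$ was the critical cluster of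 facility $i$ just before this call, then for each $j\in A'$ add a satellite cluster $(i,\{j\})$ at level $\ell(C')$, and remove $C'$ from $\mathcal{C}$. Fix-Level$(C=(i,A))$ with $k=\ell(C)$: if $\mathcal{C}(i)=\{C\}$ and $A=\emptyset$, remove $C$ from $\mathcal{C}$ and stop; if $C$ is critical, for every satellite cluster $(i,\{j\})$ at level $k$ set $A\leftarrow A\cup\{j\}$ and remove $(i,\{j\})$ from $\mathcal{C}$; finally, if still $cost_{avg}(C)\ge 2^k$, set $\ell(C)\leftarrow k+1$. *)

(* Defs.v *)
From HB Require Import structures.
From mathcomp Require Import all_boot all_order all_algebra finmap.
From mathcomp Require Import boolp classical_sets reals constructive_ereal.
From mathcomp Require Import topology.

Set Implicit Arguments.
Unset Strict Implicit.
Unset Printing Implicit Defensive.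

Import Order.TTheory GRing.Theory Num.Theory.
Local Open Scope fset_scope.
Local Open Scope ring_scope.

Record cluster (F : finType) (U : choiceType) := Cluster {
  critical : bool;
  facility : F;
  clients : {fset U}
}.

Section ClusterChoice.
Context {F : finType} {U : choiceType}.
Definition cluster_to_prod (C : cluster F U) : bool * F * {fset U} :=
  (critical C, facility C, clients C).
Definition cluster_of_prod (p : bool * F * {fset U}) : cluster F U :=
  Cluster p.1.1 p.1.2 p.2.
Lemma cluster_to_prodK : cancel cluster_to_prod cluster_of_prod.
Proof. by case. Qed.
HB.instance Definition _ :=
  Choice.copy (cluster F U) (can_type cluster_to_prodK).
End ClusterChoice.

(* An element of a clustering is a cluster together with its level. *)
Notation leveled F U := (cluster F U * int)%type.
Notation clustering F U := {fset leveled F U}.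

Inductive update (U : Type) := Insert of U | Delete of U.

Section Algorithm.
Context {R : realType} {F : finType} {U : choiceType}.
Variables (d : F -> U -> R) (f : F -> R).

Implicit Types (i : F) (j : U) (k l : int) (A D : {fset U}).
Implicit Types (C : cluster F U) (e : leveled F U) (S : clustering F U).

(* The unique integer k with 2^(k-4) <= x < 2^(k-3), for x > 0. *)
Definition scale (x : R) : int :=
  xget 0 [set k : int | 2%:R ^ (k - 4) <= x < 2%:R ^ (k - 3)]%classic.

Definition kappa i j : int := scale (d i j).

Definition cost C : R :=
  (if critical C then f (facility C) else 0)
  + \sum_(j <- clients C) d (facility C) j.

(* The average cost of a cluster without clients is +oo: such a cluster always
   violates (I1) and is never blocking. *)
Definition cost_avg C : \bar R :=
  if clients C == fset0 then +oo%E
  else (cost C / #|` clients C|%:R)%:E.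

Definition pow2 k : \bar R := (2%:R ^ k)%:E.

Definition is_cluster D C : Prop :=
  clients C `<=` D /\ (~~ critical C -> #|` clients C| = 1%N).

Definition at_facility S i : clustering F U :=
  [fset e in S | facility e.1 == i].

Definition is_open S i : Prop := at_facility S i != fset0.

Definition is_clustering D S : Prop :=
  [/\ forall e, e \in S -> is_cluster D e.1,
      forall j, j \in D -> exists! e, e \in S /\ j \in clients e.1
    & forall i, is_open S i ->
        exists! e, e \in at_facility S i /\ critical e.1].

Definition client_level S j : int :=
  xget 0 [set l : int | exists2 e, e \in S & j \in clients e.1 /\ e.2 = l]%classic.

Definition blocking D S C k : Prop :=
  [/\ is_cluster D C,
      (cost_avg C < pow2 (k - 3))%E,
      forall j, j \in clients C ->
        k < client_level S j /\ kappa (facility C) j <= k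
    & if critical C
      then forall e, e \in at_facility S (facility C) -> k <= e.2
      else exists2 e, e \in at_facility S (facility C) &
             critical e.1 /\ e.2 <= k].

Definition I1 S : Prop :=
  forall e, e \in S -> (cost_avg e.1 < pow2 e.2)%E.

Definition I2 S : Prop :=
  forall i e0 e, e0 \in at_facility S i -> critical e0.1 ->
    e \in at_facility S i -> e0.2 <= e.2.

Definition I3 S : Prop :=
  forall e j, e \in S -> j \in clients e.1 ->
    kappa (facility e.1) j <= client_level S j.

Definition I4 D S : Prop := forall C k, ~ blocking D S C k.

Definition nice D S : Prop := [/\ I1 S, I2 S, I3 S & I4 D S].

(* Since satellite clusters have exactly one client, a satellite cluster that
   loses its client disappears; a critical cluster is kept even when empty. *)
Definition remove_clients A S : clustering F U :=
  [fset e in [fset (Cluster (critical e.1) (facility e.1) (clients e.1 `\` A),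
                    e.2) | e in S]
   | critical e.1 || (clients e.1 != fset0)].

(* The clients of C are removed from the former critical cluster of its
   facility before the latter is split into satellite clusters. *)
Definition fix_blocking S C k : clustering F U :=
  let i := facility C in
  let S0 := remove_clients (clients C) S in
  if critical C then
    let old := [fset e in at_facility S0 i | critical e.1] in
    let sats := [fset ((Cluster false i [fset j], e.2) : leveled F U)
                 | e : leveled F U in old, j : U in clients e.1] in
    (C, k) |` ((S0 `\` old) `|` sats)
  else (C, k) |` S0.

Definition fix_level S e : clustering F U :=
  let: (C, k) := e in
  let i := facility C in
  if (at_facility S i == [fset e]) && (clients C == fset0) then S `\ e
  else
    let absorbed :=
      if critical C then
        [fset e' in at_facility S i | ~~ critical e'.1 && (e'.2 == k)]
      else fset0 in
    let C' := Cluster (critical C) i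
                (clients C `|` \bigcup_(e' <- absorbed) clients e'.1) in
    let k' := if (pow2 k <= cost_avg C')%E then k + 1 else k in
    (C', k') |` ((S `\ e) `\` absorbed).

(* [fix_clustering D S S']: some execution of the while loop started in S
   terminates in S'. *)
Inductive fix_clustering D : clustering F U -> clustering F U -> Prop :=
| FixDone S : I4 D S -> I1 S -> fix_clustering D S S
| FixBlocking S S' C k :
    blocking D S C k ->
    fix_clustering D (fix_blocking S C k) S' -> fix_clustering D S S'
| FixLevel S S' e :
    I4 D S -> e \in S -> ~ (cost_avg e.1 < pow2 e.2)%E ->
    fix_clustering D (fix_level S e) S' -> fix_clustering D S S'.

(* [insert_client j S S']: S' is a possible clustering just before the call to
   Fix-Clustering in the insertion of j. *)
Inductive insert_client j S : clustering F U -> Prop :=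
| InsertFirst i :
    (forall i', ~ is_open S i') ->
    (forall i', d i j + f i <= d i' j + f i') ->
    insert_client j S
      ((Cluster true i [fset j], scale (d i j + f i)) |` S)
| InsertCritical i e :
    e \in at_facility S i -> critical e.1 -> kappa i j <= e.2 ->
    insert_client j S
      ((Cluster true i (j |` clients e.1), e.2) |` (S `\ e))
| InsertSatellite i e :
    e \in at_facility S i -> critical e.1 -> e.2 < kappa i j ->
    insert_client j S ((Cluster false i [fset j], kappa i j) |` S).

Inductive process : update U -> {fset U} * clustering F U ->
    {fset U} * clustering F U -> Prop :=
| ProcessInsert j D S S1 S' :
    j \notin D -> insert_client j S S1 ->
    fix_clustering (j |` D) S1 S' ->
    process (Insert j) (D, S) (j |` D, S')
| ProcessDelete j D S S' :
    j \in D ->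
    fix_clustering (D `\ j) (remove_clients [fset j] S) S' ->
    process (Delete j) (D, S) (D `\ j, S').

(* [run us st]: st is a possible state once all the updates us, starting from
   the empty client set and the empty clustering, have been processed. *)
Inductive run : seq (update U) -> {fset U} * clustering F U -> Prop :=
| RunNil : run [::] (fset0, fset0)
| RunRcons us u st st' :
    run us st -> process u st st' -> run (rcons us u) st'.

End Algorithm.

(* Main.v *)
(** The loop ends only when (I1) and (I4) hold, so it is enough that every
    elementary step preserves the rest: being a clustering, (I2) and (I3).
    Levels drop only in Fix-Blocking, where condition (b) protects (I3) and
    condition (c) protects (I2).  When Fix-Level raises a critical cluster from
    level [k] to [k + 1], the satellites of the same facility at level [k] have
    just been absorbed, so by (I2) the remaining ones have level at least
    [k + 1].  For the first insertion, (I3) holds because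
    [d i j <= d i j + f i]. *)
Require Import Defs.
From HB Require Import structures.
From mathcomp Require Import all_boot all_order all_algebra finmap.
From mathcomp Require Import boolp classical_sets reals constructive_ereal.
From mathcomp Require Import topology.
From mathcomp Require Import zify.

Set Implicit Arguments.
Unset Strict Implicit.
Unset Printing Implicit Defensive.

Import Order.TTheory GRing.Theory Num.Theory.
Local Open Scope fset_scope.
Local Open Scope ring_scope.

(** * Dyadic scales of positive reals *)

Section Scale.
Context {R : realType}.
Implicit Types x y : R.

(** Archimedean property on both sides: some [2 ^ (- m)] lies below [x], so the exponents to be
    searched can be written [n - m] with [n] natural, and the least one with [x < 2 ^ (n - m)]
    exists. *)
Lemma exists_scale x : 0 < x ->
  exists k : int, 2%:R ^ (k - 4) <= x < 2%:R ^ (k - 3).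
Proof.
move=> x_gt0.
have two_gt0 : 0 < 2%:R :> R by rewrite ltr0n.
have two_unit : (2%:R : R) != 0 by rewrite gt_eqF.
pose m := Num.bound x^-1.
have lt_m : 2%:R ^ (- m%:Z) < x.
  rewrite -exprnN -[x]invrK ltf_pV2 ?posrE ?invr_gt0 ?exprn_gt0 //.
  exact: (upper_nthrootP (leqnn m)).
have ex_n : exists n : nat, x < 2%:R ^ (n%:Z - m%:Z).
  exists (Num.bound x + m)%N; rewrite PoszD addrK -exprnP.
  exact: (upper_nthrootP (leqnn _)).
(* The least exponent is not [- m], by [lt_m], so it has a predecessor, whose minimality gives the
   lower bound. *)
have [[|n] lt_n min_n] := ex_minnP ex_n.
  by move: lt_n; rewrite sub0r => /(lt_trans lt_m); rewrite ltxx.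
exists (n%:Z - m%:Z + 4); apply/andP; split.
  rewrite addrK leNgt; apply/negP => /min_n; by rewrite ltnn.
by move: lt_n; congr (_ < _ ^ _); lia.
Qed.

Lemma scaleP x : 0 < x ->
  2%:R ^ (scale x - 4) <= x < 2%:R ^ (scale x - 3).
Proof.
by move/exists_scale=> [k kP]; rewrite /scale; case: xgetP => [l _ //|/(_ k)].
Qed.

(** Chaining [2 ^ (scale x - 4) <= x <= y < 2 ^ (scale y - 3)] gives [scale x - 4 < scale y - 3],
    and strictness between integers absorbs the difference of one. *)
Lemma le_scale x y : 0 < x -> x <= y -> scale x <= scale y.
Proof.
move=> x_gt0 le_xy.
have /andP[le_x _] := scaleP x_gt0.
have /andP[_ lt_y] := scaleP (lt_le_trans x_gt0 le_xy).
have := le_lt_trans le_x (le_lt_trans le_xy lt_y).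
by rewrite ltr_eXz2l ?ltr1n //; lia.
Qed.

End Scale.

(** * The loop invariant and its consequences *)

Section Invariant.
Context {R : realType} {F : finType} {U : choiceType}.
Variables (d : F -> U -> R) (f : F -> R).

Implicit Types (i : F) (j : U) (k : int) (A D : {fset U}).
Implicit Types (C : Defs.cluster F U) (e : leveled F U) (S : clustering F U).

(* [is_clustering], (I2) and (I3), with every [exists!] split and the level of
   a client replaced by the level of its cluster. *)
Record invariant D S : Prop := Invariant {
  inv_sub : forall e j, e \in S -> j \in clients e.1 -> j \in D;
  inv_sat : forall e, e \in S -> ~~ critical e.1 -> #|` clients e.1| = 1%N;
  inv_cover : forall j, j \in D -> exists2 e, e \in S & j \in clients e.1;
  inv_disj : forall e e' j, e \in S -> e' \in S ->
    j \in clients e.1 -> j \in clients e'.1 -> e = e';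
  inv_crit : forall e, e \in S ->
    exists2 e0, e0 \in S & critical e0.1 /\ facility e0.1 = facility e.1;
  inv_crit_uniq : forall e e', e \in S -> e' \in S ->
    critical e.1 -> critical e'.1 -> facility e.1 = facility e'.1 -> e = e';
  inv_crit_level : forall e0 e, e0 \in S -> e \in S -> critical e0.1 ->
    facility e0.1 = facility e.1 -> e0.2 <= e.2;
  inv_kappa : forall e j, e \in S -> j \in clients e.1 ->
    kappa d (facility e.1) j <= e.2
}.

Lemma in_at_facility S i e :
  (e \in at_facility S i) = (e \in S) && (facility e.1 == i).
Proof. by rewrite !inE. Qed.

Lemma invariant_is_clustering D S : invariant D S -> is_clustering D S.
Proof.
move=> inv; split.
- move=> e eS; split; last exact: inv_sat inv _ eS.
  by apply/fsubsetP => j; apply: inv_sub inv _ _ eS.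
- move=> j jD; have [e eS je] := inv_cover inv jD.
  exists e; split=> // e' [e'S je']; exact: inv_disj inv _ _ _ eS e'S je je'.
- move=> i /fset0Pn[e]; rewrite in_at_facility => /andP[eS /eqP ei].
  have [e0 e0S [cr0 e0i]] := inv_crit inv eS.
  exists e0; split.
    by rewrite in_at_facility e0S e0i ei eqxx.
  move=> e'; rewrite in_at_facility => -[/andP[e'S /eqP e'i] cr'].
  by apply: inv_crit_uniq inv _ _ _ _ _ _ _ => //; rewrite e0i ei.
Qed.

(** Disjointness makes the set of levels of [j] a singleton, so [xget] returns its element and not
    the default 0. *)
Lemma client_levelE D S e j : invariant D S ->
  e \in S -> j \in clients e.1 -> client_level S j = e.2.
Proof.
move=> inv eS je; rewrite /client_level; case: xgetP => [l _ [e' e'S [je' <-]]|].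
  by rewrite (inv_disj inv eS e'S je je').
by move/(_ e.2)/(_ (ex_intro2 _ _ e eS (conj je erefl))).
Qed.

Lemma invariant_I2 D S : invariant D S -> I2 S.
Proof.
move=> inv i e0 e; rewrite !in_at_facility => /andP[e0S /eqP e0i] cr0.
by move=> /andP[eS /eqP ei]; apply: inv_crit_level inv _ _ _ _ _ _; rewrite ?e0i.
Qed.

Lemma invariant_I3 D S : invariant D S -> I3 d S.
Proof.
move=> inv e j eS je; rewrite (client_levelE inv eS je).
exact: inv_kappa inv _ _ eS je.
Qed.

Lemma invariant0 : invariant fset0 fset0.
Proof. by split=> // j; rewrite inE. Qed.

(** * Elementary modifications: removing clients, adding a satellite, replacing a critical
    cluster *)

Lemma remove_clientsP A S e :
  reflect (exists2 e1, e1 \in S &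
             e = (Cluster (critical e1.1) (facility e1.1) (clients e1.1 `\` A),
                  e1.2)
             /\ (critical e.1 || (clients e.1 != fset0)))
          (e \in remove_clients A S).
Proof.
rewrite /remove_clients !inE /=; apply: (iffP andP).
  by move=> [/imfsetP[e1 /= e1S ->] ne]; exists e1.
by move=> [e1 e1S [-> ne]]; split=> //; apply/imfsetP; exists e1.
Qed.

(** Serves both the deletion of a client and the first stage of Fix-Blocking. Each surviving cluster
    is a shrunk one with the same kind, facility and level; critical clusters survive even when
    empty, so no facility loses its critical cluster while keeping satellites. *)
Lemma invariant_remove A D S :
  invariant D S -> invariant (D `\` A) (remove_clients A S).
Proof.
move=> inv; split.
- move=> e j /remove_clientsP[e1 e1S [-> _]] /=; rewrite !inE.
  by move=> /andP[-> je1]; exact: inv_sub inv _ _ e1S je1.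
- move=> e /remove_clientsP[e1 e1S [-> /= ne]] sat; rewrite (negPf sat) /= in ne.
  apply/eqP; rewrite eqn_leq cardfs_gt0 ne andbT -(inv_sat inv e1S sat).
  exact: fsubset_leq_card (fsubsetDl _ _).
- move=> j; rewrite inE => /andP[jA jD]; have [e eS je] := inv_cover inv jD.
  exists (Cluster (critical e.1) (facility e.1) (clients e.1 `\` A), e.2).
    apply/remove_clientsP; exists e => //; split=> //=.
    by apply/orP; right; apply/fset0Pn; exists j; rewrite inE jA.
  by rewrite /= inE jA.
- move=> e e' j /remove_clientsP[e1 e1S [-> _]] /remove_clientsP[e2 e2S [-> _]].
  rewrite /= !inE => /andP[_ j1] /andP[_ j2].
  by rewrite (inv_disj inv e1S e2S j1 j2).
- move=> e /remove_clientsP[e1 e1S [-> _]].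
  have [e0 e0S [cr0 e01]] := inv_crit inv e1S.
  exists (Cluster (critical e0.1) (facility e0.1) (clients e0.1 `\` A), e0.2) => //.
  by apply/remove_clientsP; exists e0 => //; rewrite /= cr0.
- move=> e e' /remove_clientsP[e1 e1S [-> _]] /remove_clientsP[e2 e2S [-> _]] /=.
  by move=> c1 c2 e12; rewrite (inv_crit_uniq inv e1S e2S c1 c2 e12).
- move=> e e' /remove_clientsP[e1 e1S [-> _]] /remove_clientsP[e2 e2S [-> _]] /=.
  exact: inv_crit_level inv _ _ e1S e2S.
- move=> e j /remove_clientsP[e1 e1S [-> _]] /=; rewrite inE => /andP[_].
  exact: inv_kappa inv _ _ e1S.
Qed.

(** Shared by insertion, Fix-Blocking and Fix-Level. The critical cluster [e0] witnesses that [i] is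
    open, and [e0.2 <= k] preserves (I2). *)
Lemma invariant_add_satellite D S i j k e0 :
  invariant D S -> j \notin D -> e0 \in S -> critical e0.1 ->
  facility e0.1 = i -> e0.2 <= k -> kappa d i j <= k ->
  invariant (j |` D) ((Cluster false i [fset j], k) |` S).
Proof.
move=> inv jD e0S cr0 e0i le_k kap.
have not_j e : e \in S -> j \notin clients e.1.
  by move=> eS; apply: contra jD; exact: inv_sub inv _ _ eS.
split.
- move=> e j'; rewrite !inE => /orP[/eqP->/=|eS je]; first by rewrite inE => ->.
  by rewrite (inv_sub inv eS je) orbT.
- move=> e; rewrite !inE => /orP[/eqP->/= _|]; first by rewrite cardfs1.
  exact: inv_sat inv _.
- move=> j'; rewrite !inE => /orP[/eqP->|/(inv_cover inv)[e eS je]].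
    by exists (Cluster false i [fset j], k); rewrite ?inE ?eqxx.
  by exists e; rewrite // inE eS orbT.
- move=> e e' j'; rewrite !inE => /orP[/eqP->|eS] /orP[/eqP->|e'S] //=.
  + by rewrite inE => /eqP->; rewrite (negPf (not_j _ e'S)).
  + by rewrite inE => + /eqP j'j; rewrite j'j (negPf (not_j _ eS)).
  + exact: inv_disj inv _ _ _ eS e'S.
- move=> e; rewrite !inE => /orP[/eqP->|/(inv_crit inv)[e1 e1S e1P]].
    by exists e0; rewrite ?inE ?e0S ?orbT.
  by exists e1; rewrite ?inE ?e1S ?orbT.
- move=> e e'; rewrite !inE => /orP[/eqP->|eS] /orP[/eqP->|e'S] //=.
  exact: inv_crit_uniq inv _ _ eS e'S.
- move=> e e'; rewrite !inE => /orP[/eqP->|eS] /orP[/eqP->|e'S] //=.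
    by move=> cr ei; rewrite (inv_crit_uniq inv eS e0S cr cr0) // e0i.
  exact: inv_crit_level inv _ _ eS e'S.
- move=> e j'; rewrite !inE => /orP[/eqP->/=|]; first by rewrite inE => /eqP->.
  exact: inv_kappa inv _ _.
Qed.

(** Common form of inserting a client into a critical cluster ([A] a singleton, nothing absorbed)
    and of Fix-Level on a critical cluster ([A] empty). Absorbed clusters have level at most [k],
    which keeps the bound on [kappa]; unabsorbed satellites have level at least [k], which keeps
    (I2). *)
Lemma invariant_replace_critical D S e absorbed A k :
  invariant D S -> e \in S -> critical e.1 ->
  absorbed `<=` [fset e' in at_facility S (facility e.1) | ~~ critical e'.1] ->
  [disjoint A & D]%fset ->
  (forall e', e' \in absorbed -> e'.2 <= k) -> e.2 <= k ->
  (forall e', e' \in at_facility S (facility e.1) -> ~~ critical e'.1 ->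
     e' \notin absorbed -> k <= e'.2) ->
  (forall j, j \in A -> kappa d (facility e.1) j <= k) ->
  invariant (A `|` D)
    ((Cluster true (facility e.1)
        (A `|` clients e.1 `|` \bigcup_(e' <- absorbed) clients e'.1), k)
     |` ((S `\ e) `\` absorbed)).
Proof.
move=> inv eS cre /fsubsetP abs AD abs_k e_k k_rest A_k.
have absP e' : e' \in absorbed ->
    [/\ e' \in S, facility e'.1 = facility e.1 & ~~ critical e'.1].
  by move/abs; rewrite !inE => /andP[/andP[? /eqP->] ->].
set B := A `|` clients e.1 `|` _; set n := (_, k).
have notA e' j : e' \in S -> j \in clients e'.1 -> j \notin A.
  move=> e'S je'; apply/negP => jA; move/fdisjointP: AD => /(_ _ jA).
  by rewrite (inv_sub inv e'S je').
(* Each client of the new cluster is either new or comes from a cluster of the same facility at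
   level at most [k]. *)
have BP j : j \in B ->
    j \in A \/ exists e', [/\ e' \in S, j \in clients e'.1,
      facility e'.1 = facility e.1, e'.2 <= k & e' = e \/ e' \in absorbed].
  rewrite /B !in_fsetU -orbA => /or3P[jA|je|/bigfcupP[e' /andP[e'a _] je']].
  - by left.
  - by right; exists e; split=> //; left.
  - right; exists e'; have [e'S e'i _] := absP _ e'a.
    by split=> //; [exact: abs_k | right].
have restP e' : e' \in (S `\ e) `\` absorbed ->
    [/\ e' \in S, e' != e & e' \notin absorbed].
  by rewrite !inE => /and3P[? ? ?].
(* Since [e] was the only critical cluster of its facility, only satellites remain there beside the
   new one. *)
have rest_sat e' : e' \in (S `\ e) `\` absorbed ->
    facility e'.1 = facility e.1 -> ~~ critical e'.1.
  move=> /restP[e'S ne _] e'i; apply: contra ne => cr.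
  by rewrite (inv_crit_uniq inv e'S eS cr cre e'i).
have rest_disj e' j : e' \in (S `\ e) `\` absorbed ->
    j \in clients e'.1 -> j \notin B.
  move=> /restP[e'S ne na] je'; apply/negP => /BP[|[e2 [e2S je2 _ _ e2P]]].
    by rewrite (negPf (notA _ _ e'S je')).
  have e2e := inv_disj inv e2S e'S je2 je'.
  by case: e2P => e2P; move: ne na; rewrite -e2e e2P ?eqxx.
split.
- move=> e' j; rewrite in_fset1U => /orP[/eqP->/= /BP[jA|]|].
  - by rewrite in_fsetU jA.
  - by move=> [e2 [e2S je2 _ _ _]]; rewrite in_fsetU (inv_sub inv e2S je2) orbT.
  by move=> /restP[e'S _ _] je'; rewrite inE (inv_sub inv e'S je') orbT.
- move=> e'; rewrite in_fset1U => /orP[/eqP->//|/restP[e'S _ _]].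
  exact: inv_sat inv _ e'S.
- move=> j; rewrite inE => /orP[jA|jD].
    by exists n; [exact: fset1U1 | rewrite /= !in_fsetU jA].
  have [e' e'S je'] := inv_cover inv jD.
  have [jB|jB] := boolP (j \in B); first by exists n; rewrite ?fset1U1.
  exists e' => //; move: jB; rewrite !inE e'S !negb_or -!andbA => /and3P[_ je ja].
  apply/orP; right; apply/and3P; split=> //.
    by apply: contra ja => e'a; apply/bigfcupP; exists e'; rewrite ?e'a.
  by apply: contra je => /eqP<-.
- move=> e1 e2 j; rewrite !in_fset1U => /orP[/eqP->|e1S] /orP[/eqP->|e2S] //=.
  + by move=> jB /(rest_disj _ _ e2S); rewrite jB.
  + by move=> /(rest_disj _ _ e1S)/negPf->.
  + move: e1S e2S => /restP[e1S _ _] /restP[e2S _ _].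
    exact: inv_disj inv _ _ _ e1S e2S.
- move=> e'; rewrite in_fset1U => /orP[/eqP->|e'r].
    by exists n; rewrite ?fset1U1.
  have [e'S _ _] := restP _ e'r.
  have [e0 e0S [cr0 e0i]] := inv_crit inv e'S.
  have [e0e|ne] := eqVneq e0 e.
    by exists n; [exact: fset1U1 | rewrite /= -e0i e0e].
  exists e0 => //; rewrite !inE ne e0S !andbT; apply/orP; right.
  by apply/negP => /absP[_ _]; rewrite cr0.
- move=> e1 e2; rewrite !in_fset1U => /orP[/eqP->|e1S] /orP[/eqP->|e2S] //=.
  + by move=> _ cr /esym /(rest_sat _ e2S); rewrite cr.
  + by move=> cr _ /(rest_sat _ e1S); rewrite cr.
  + move: e1S e2S => /restP[e1S _ _] /restP[e2S _ _].
    exact: inv_crit_uniq inv _ _ e1S e2S.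
- move=> e1 e2; rewrite !in_fset1U => /orP[/eqP->|e1S] /orP[/eqP->|e2S] //=.
  + move=> _ /esym e2i; have [e2S' _ na] := restP _ e2S.
    by apply: k_rest na; rewrite ?in_at_facility ?e2S' ?e2i ?eqxx ?(rest_sat _ e2S).
  + by move=> cr /(rest_sat _ e1S); rewrite cr.
  + move: e1S e2S => /restP[e1S _ _] /restP[e2S _ _].
    exact: inv_crit_level inv _ _ e1S e2S.
- move=> e' j; rewrite in_fset1U => /orP[/eqP->/=|/restP[e'S _ _]].
    move=> /BP[/A_k//|[e2 [e2S je2 <- le_k _]]].
    exact: le_trans (inv_kappa inv e2S je2) le_k.
  exact: inv_kappa inv _ _ e'S.
Qed.

(** * Fix-Blocking *)

(** If [C] is critical, every other cluster of the result is contained in a cluster of [S0] with the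
    same facility and level, so the properties are pulled back from [S0]. If [C] is a satellite, the
    step amounts to removing its client and adding it back as a satellite. *)
Lemma invariant_fix_blocking D S C k :
  invariant D S -> blocking d f D S C k -> invariant D (fix_blocking S C k).
Proof.
move=> inv [[/fsubsetP CD Csat] _ Clev Ck]; rewrite /fix_blocking.
have DE : clients C `|` (D `\` clients C) = D.
  by apply/fsetP => j; rewrite !inE; case: (boolP (j \in clients C)) => //= /CD.
have := invariant_remove (clients C) inv.
set S0 := remove_clients _ S => inv0.
case: ifP => crC; rewrite crC in Ck.
  (* Condition (c) speaks of [S]; it passes to [S0] because shrinking changes neither facilities nor
     levels. *)
  have k_le e : e \in S0 -> facility e.1 = facility C -> k <= e.2.
    move=> /remove_clientsP[e1 e1S [-> _]] /= e1i.
    by apply: Ck; rewrite in_at_facility e1S e1i eqxx.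
  clearbody S0.
  set old := [fset e in _ | _]; set sats := [fset _ | e in _, j in _].
  have oldP e : e \in old ->
      [/\ e \in S0, facility e.1 = facility C & critical e.1].
    by rewrite !inE => /andP[/andP[-> /eqP->] ->].
  have in_old e : e \in S0 -> facility e.1 = facility C -> critical e.1 ->
      e \in old.
    by move=> eS ei cre; rewrite !inE eS ei cre eqxx.
  have satsP e : e \in sats -> exists2 e1, e1 \in old & exists2 j,
      j \in clients e1.1 & e = (Cluster false (facility C) [fset j], e1.2).
    by move=> /imfset2P[e1 /= e1o [j je1 ->]]; exists e1 => //; exists j.
  pose mem e := [\/ e = (C, k), e \in S0 /\ e \notin old | e \in sats].
  have memP e : e \in (C, k) |` ((S0 `\` old) `|` sats) -> mem e.
    rewrite in_fset1U in_fsetU in_fsetD => /or3P[/eqP|/andP[? ?]|?];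
      by [constructor 1 | constructor 2 | constructor 3].
  have memE e : mem e -> e \in (C, k) |` ((S0 `\` old) `|` sats).
    rewrite in_fset1U in_fsetU in_fsetD.
    by case=> [->|[-> ->]|->]; rewrite ?eqxx ?orbT.
  move: memP memE; set S1 := _ |` _ => memP memE.
  (* The last clause says that splitting leaves no critical cluster at the facility of [C] other
     than [(C, k)], and that the critical clusters elsewhere are unchanged. *)
  have refine e : e \in S1 -> e != (C, k) -> exists2 e1, e1 \in S0 &
      [/\ {subset clients e.1 <= clients e1.1}, facility e.1 = facility e1.1
        , e.2 = e1.2 & critical e.1 -> e = e1 /\ facility e.1 <> facility C].
    move=> /memP[->|[eS eo]|/satsP[e1 e1o [j je1 ->]]]; first by rewrite eqxx.
      move=> _; exists e => //; split=> // cre; split=> // ei.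
      by move: eo; rewrite in_old.
    move=> _; have [e1S e1i _] := oldP _ e1o; exists e1 => //; split=> //.
    by move=> j'; rewrite inE => /eqP->.
  have notC e j : e \in S1 -> e != (C, k) -> j \in clients e.1 ->
      j \notin clients C.
    move=> eS ne je; have [e1 e1S [sub _ _ _]] := refine _ eS ne.
    by have := inv_sub inv0 e1S (sub _ je); rewrite inE => /andP[].
  split.
  - move=> e j eS je; have [eC|ne] := eqVneq e (C, k).
      by apply: CD; rewrite eC in je.
    have [e1 e1S [sub _ _ _]] := refine _ eS ne.
    by have := inv_sub inv0 e1S (sub _ je); rewrite inE => /andP[].
  - move=> e /memP[->/=|[eS _]|/satsP[e1 e1o [j je1 ->]] _]; first by rewrite crC.
      exact: inv_sat inv0 _ eS.
    by rewrite cardfs1.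
  - move=> j jD; have [jC|jC] := boolP (j \in clients C).
      by exists (C, k) => //; apply: memE; constructor 1.
    have [|e eS je] := inv_cover inv0 (j := j); first by rewrite inE jC.
    have [eo|eo] := boolP (e \in old).
      exists (Cluster false (facility C) [fset j], e.2); last by rewrite inE.
      by apply: memE; constructor 3; apply/imfset2P; exists e => //; exists j.
    by exists e => //; apply: memE; constructor 2.
  - move=> e e' j eS e'S je je'.
    have [eC|ne] := eqVneq e (C, k); have [e'C|ne'] := eqVneq e' (C, k).
    + by rewrite eC e'C.
    + by move: (notC _ _ e'S ne' je'); rewrite eC in je; rewrite je.
    + by move: (notC _ _ eS ne je); rewrite e'C in je'; rewrite je'.
    move: (memP _ eS) (memP _ e'S) je je' ne ne'.
    case=> [->|[eS0 eo]|/satsP[e1 e1o [j1 je1 ->]]]; rewrite ?eqxx //.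
    + case=> [->|[e'S0 e'o]|/satsP[e1' e1'o [j1' je1' ->]]]; rewrite ?eqxx //.
        by move=> je je' _ _; exact: inv_disj inv0 _ _ _ eS0 e'S0 je je'.
      move=> je; rewrite inE => /eqP jj; rewrite -jj in je1'.
      have [e1'S _ _] := oldP _ e1'o.
      by move: eo; rewrite (inv_disj inv0 eS0 e1'S je je1') e1'o.
    + case=> [->|[e'S0 e'o]|/satsP[e1' e1'o [j1' je1' ->]]]; rewrite ?eqxx //.
        rewrite inE => /eqP jj je'; rewrite -jj in je1.
        have [e1S _ _] := oldP _ e1o.
        by move: e'o; rewrite (inv_disj inv0 e'S0 e1S je' je1) e1o.
      rewrite !inE => /eqP <- /eqP <- _ _.
      (* Two new satellites with the same client could still differ in level; they do not, because
         both come from the unique former critical cluster. *)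
      have [e1S i1 c1] := oldP _ e1o; have [e1'S i1' c1'] := oldP _ e1'o.
      by rewrite (inv_crit_uniq inv0 e1S e1'S c1 c1') // i1.
  - move=> e eS; have [ei|ei] := eqVneq (facility e.1) (facility C).
      by exists (C, k); rewrite ?ei //; apply: memE; constructor 1.
    have ne : e != (C, k) by apply: contra ei => /eqP->.
    have [e1 e1S [_ ei1 _ _]] := refine _ eS ne.
    have [e0 e0S [cr0 e0i]] := inv_crit inv0 e1S.
    exists e0; last by rewrite ei1.
    apply: memE; constructor 2; split=> //; apply/negP => /oldP[_ e0C _].
    by move: ei; rewrite ei1 -e0i e0C eqxx.
  - move=> e e' eS e'S cre cre' ee'.
    have [eC|ne] := eqVneq e (C, k); have [e'C|ne'] := eqVneq e' (C, k).
    + by rewrite eC e'C.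
    + by have [e1 _ [_ _ _ /(_ cre')[_]]] := refine _ e'S ne'; rewrite -ee' eC.
    + by have [e1 _ [_ _ _ /(_ cre)[_]]] := refine _ eS ne; rewrite ee' e'C.
    have [e1 e1S [_ _ _ /(_ cre)[E _]]] := refine _ eS ne.
    have [e1' e1'S [_ _ _ /(_ cre')[E' _]]] := refine _ e'S ne'.
    by rewrite E E'; apply: (inv_crit_uniq inv0 e1S e1'S); rewrite -?E -?E'.
  - move=> e0 e e0S eS cr0 e0e.
    have [eC|ne] := eqVneq e (C, k); have [e0C|ne0] := eqVneq e0 (C, k).
    + by rewrite eC e0C.
    + by have [e1 _ [_ _ _ /(_ cr0)[_]]] := refine _ e0S ne0; rewrite e0e eC.
    + have [e1 e1S [_ ei -> _]] := refine _ eS ne.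
      by rewrite e0C; apply: k_le; rewrite // -ei -e0e e0C.
    have [e1 e1S [_ ei1 -> _]] := refine _ eS ne.
    have [e1' e1'S [_ _ _ /(_ cr0)[E _]]] := refine _ e0S ne0.
    by rewrite E; apply: (inv_crit_level inv0 e1'S e1S); rewrite -E // e0e.
  - move=> e j eS je; have [eC|ne] := eqVneq e (C, k).
      by move: je; rewrite eC => /Clev[].
    have [e1 e1S [sub -> -> _]] := refine _ eS ne.
    exact: inv_kappa inv0 _ _ e1S (sub _ je).
(* Satellite case: the critical cluster given by condition (c) survives the removal, possibly
   shrunk, at its level [e0.2 <= k]. *)
move: Csat; rewrite crC => /(_ isT)/eqP/cardfs1P[j Cj].
have [e0 + [cr0 e0k]] := Ck; rewrite in_at_facility => /andP[e0S /eqP e0i].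
have CE : C = Cluster false (facility C) [fset j].
  by rewrite -Cj -crC; case: (C).
rewrite [in X in X |` _]CE -DE {1}Cj.
apply: (invariant_add_satellite
  (e0 := (Cluster true (facility e0.1) (clients e0.1 `\` clients C), e0.2))) => //=.
- by rewrite Cj !inE eqxx.
- apply/remove_clientsP; exists e0; rewrite //= cr0; split=> //.
- by have [|] := Clev j; rewrite ?Cj ?inE.
Qed.

(** * Fix-Level *)

(** Removing the only cluster closes its facility, so no satellite is left without a critical
    cluster, and emptiness of [e] means that no client becomes uncovered. *)
Lemma invariant_remove_alone D S e :
  invariant D S -> at_facility S (facility e.1) = [fset e] ->
  clients e.1 = fset0 -> invariant D (S `\ e).
Proof.
move=> inv alone empty; have subS e' : e' \in S `\ e -> e' \in S.
  by rewrite !inE => /andP[].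
split.
- by move=> e' j /subS; exact: inv_sub inv _ _.
- by move=> e' /subS; exact: inv_sat inv _.
- move=> j /(inv_cover inv)[e' e'S je']; exists e' => //; rewrite !inE e'S andbT.
  by apply: contraTneq je' => ->; rewrite empty inE.
- by move=> e1 e2 j /subS e1S /subS e2S; exact: inv_disj inv _ _ _ e1S e2S.
- move=> e' e'S; have [e0 e0S [cr0 e0i]] := inv_crit inv (subS _ e'S).
  exists e0 => //; rewrite !inE e0S andbT; apply/eqP => e0e.
  have : e' \in at_facility S (facility e.1).
    by rewrite in_at_facility subS // -e0i e0e eqxx.
  by rewrite alone inE => /eqP e'e; move: e'S; rewrite e'e !inE eqxx.
- by move=> e1 e2 /subS e1S /subS e2S; exact: inv_crit_uniq inv _ _ e1S e2S.
- by move=> e1 e2 /subS e1S /subS e2S; exact: inv_crit_level inv _ _ e1S e2S.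
- by move=> e' j /subS; exact: inv_kappa inv _ _.
Qed.

(** Raising a satellite is the same as deleting its client and adding it back as a satellite at the
    higher level. *)
Lemma invariant_raise_satellite D S e k :
  invariant D S -> e \in S -> ~~ critical e.1 -> e.2 <= k ->
  invariant D ((e.1, k) |` (S `\ e)).
Proof.
move=> inv eS sat le_k.
have [j ej] : exists j, clients e.1 = [fset j].
  by apply/cardfs1P; rewrite (inv_sat inv eS sat).
have je : j \in clients e.1 by rewrite ej inE.
have jD := inv_sub inv eS je.
have [e0 e0S [cr0 e0i]] := inv_crit inv eS.
have eE : e.1 = Cluster false (facility e.1) [fset j].
  by rewrite -ej -(negPf sat); case: (e.1).
(* By disjointness only [e] contains [j]; being a satellite, it becomes empty and is filtered out,
   while all other clusters are unchanged. *)
have SE : S `\ e = remove_clients [fset j] S.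
  have keep e1 : e1 \in S -> e1 != e ->
      (Cluster (critical e1.1) (facility e1.1) (clients e1.1 `\ j), e1.2) = e1.
    move=> e1S ne; have je1 : j \notin clients e1.1.
      by apply: contra ne => je1; rewrite (inv_disj inv e1S eS je1 je).
    by rewrite mem_fsetD1 //; case: (e1) => -[].
  apply/fsetP => e'; apply/idP/remove_clientsP.
    rewrite !inE => /andP[ne e'S]; exists e' => //; rewrite keep //; split=> //.
    case: (boolP (critical e'.1)) => //= sat'.
    by rewrite -cardfs_gt0 (inv_sat inv e'S sat').
  move=> [e1 e1S [-> /=]]; have [->|ne] := eqVneq e1 e.
    by rewrite (negPf sat) ej fsetDv eqxx.
  by rewrite keep // !inE ne e1S.
rewrite eE SE -(fsetD1K jD).
apply: (invariant_add_satellite (e0 := e0)) => //.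
- exact: invariant_remove.
- by rewrite !inE eqxx.
- rewrite -SE !inE e0S andbT; by apply: contraTneq cr0 => ->.
- exact: le_trans (inv_crit_level inv e0S eS cr0 e0i) le_k.
- exact: le_trans (inv_kappa inv eS je) le_k.
Qed.

Lemma invariant_fix_level D S e :
  invariant D S -> e \in S -> invariant D (fix_level d f S e).
Proof.
move=> inv; case: e => C k eS; rewrite /fix_level.
case: ifP => [/andP[/eqP alone /eqP empty]|_].
  exact: invariant_remove_alone.
set k' := if (_ <= _)%E then _ else _.
have k'P : k <= k' <= k + 1 by rewrite /k'; case: ifP => _; lia.
have /andP[k_k' k'_k] := k'P.
(* From here on only the bounds [k <= k' <= k + 1] are used, so both outcomes of the level test are
   treated at once. *)
move: k' {k'P} k_k' k'_k => k' k_k' k'_k.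
case: (boolP (critical C)) => crC; last first.
  (* A satellite absorbs nothing, so the cluster keeps its clients and only its level may change. *)
  rewrite (_ : Cluster _ _ _ = C).
    by rewrite fsetD0; exact: (invariant_raise_satellite (e := (C, k))).
  rewrite big_seq_fset0 fsetU0; by case: (C) crC => -[].
set absorbed := [fset e' in _ | _].
have := @invariant_replace_critical D S (C, k) absorbed fset0 k'
  inv eS crC.
rewrite !fset0U; apply=> //=.
- by apply/fsubsetP => e'; rewrite !inE => /andP[-> /andP[-> _]].
- exact: fdisjoint0X.
- by move=> e'; rewrite !inE => /and3P[_ _ /eqP->].
- move=> e'; rewrite in_at_facility => /andP[e'S /eqP e'i] sat.
  rewrite !inE e'S e'i eqxx sat /= => ne.
  (* The level of [e'] is at least [k] and, as [e'] is not absorbed, different from [k]; hence it is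
     at least [k + 1], which bounds [k']. *)
  have := inv_crit_level inv eS e'S crC (esym e'i); rewrite /=.
  lia.
Qed.

(** * The whole loop, insertions and runs *)

(** A terminating execution is a finite derivation; the invariant is pushed along it, and (I4) and
    (I1) are read off its final [FixDone]. *)
Lemma invariant_fix_clustering D S S' :
  fix_clustering d f D S S' -> invariant D S ->
  [/\ invariant D S', I4 d f D S' & I1 d f S'].
Proof.
elim=> {S S'} [S i4 i1 inv|S S' C k blk _ IH inv|S S' e _ eS _ _ IH inv] //.
  exact/IH/invariant_fix_blocking.
exact/IH/invariant_fix_level.
Qed.

Hypothesis d_gt0 : forall i j, 0 < d i j.
Hypothesis f_ge0 : forall i, 0 <= f i.

Lemma invariant_insert D S j S' :
  invariant D S -> j \notin D -> insert_client d f j S S' ->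
  invariant (j |` D) S'.
Proof.
move=> inv jD [i closed _|i e|i e].
(* With no open facility there is no cluster, and then, by covering, no earlier client: the new
   cluster is the whole clustering. *)
- have S0 : S = fset0.
    apply/eqP; apply/negPn/negP => /fset0Pn[e eS].
    apply: (closed (facility e.1)); apply/fset0Pn; exists e.
    by rewrite in_at_facility eS eqxx.
  have D0 : D = fset0.
    apply/eqP; apply/negPn/negP => /fset0Pn[j' /(inv_cover inv)[e]].
    by rewrite S0 inE.
  rewrite S0 D0 !fsetU0; set n := (_, _); split.
  + by move=> e j' /fset1P->.
  + by move=> e /fset1P->.
  + by move=> j' j'j; exists n; first exact: fset11.
  + by move=> e e' j' /fset1P-> /fset1P->.
  + by move=> e /fset1P->; exists n; first exact: fset11.
  + by move=> e e' /fset1P-> /fset1P->.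
  + by move=> e e' /fset1P-> /fset1P->.
  (* The bound on [kappa] is monotonicity of [scale] from [d i j] to [d i j + f i]; this uses
     [d_gt0] and [f_ge0]. *)
  + move=> e j' /fset1P-> /= /fset1P->.
    by apply: le_scale; rewrite ?lerDl.
- rewrite in_at_facility => /andP[eS /eqP ei] cre kap.
  have := @invariant_replace_critical D S e fset0 [fset j] e.2 inv eS cre.
  rewrite big_seq_fset0 fsetU0 fsetD0 ei; apply=> //.
  + by rewrite fdisjoint1X.
  + move=> e'; rewrite in_at_facility => /andP[e'S /eqP e'i] _ _.
    by apply: inv_crit_level inv _ _ _ _ _ _; rewrite ?e'i.
  + by move=> j'; rewrite inE => /eqP->.
- rewrite in_at_facility => /andP[eS /eqP ei] cre kap.
  exact: (invariant_add_satellite inv jD eS cre ei (ltW kap)).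
Qed.

(** Only the invariant is carried from one update to the next; (I1) and (I4) come afresh from each
    call to Fix-Clustering. *)
Lemma invariant_run us st : run d f us st ->
  [/\ invariant st.1 st.2, I4 d f st.1 st.2 & I1 d f st.2].
Proof.
elim=> {us st} [|us u st st' _ [inv _ _] pr].
  split; [exact: invariant0 | | by []].
  (* A cluster within the empty client set has no clients, so its average cost is [+oo] and
     condition (a) of blocking fails. *)
  move=> C k [[CD _] avg _ _]; move: avg; rewrite /cost_avg.
  by rewrite (_ : clients C == fset0) //; rewrite -fsubset0.
case: pr inv => {u st st'} j D S => [S1 S'|S'] jD.
  move=> ins fixS /= inv; apply: invariant_fix_clustering fixS _.
  exact: invariant_insert ins.
move=> fixS /= inv; apply: invariant_fix_clustering fixS _.
exact: invariant_remove.
Qed.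

End Invariant.

(** * Niceness after every update, for distances in a metric space *)

Theorem theorem3 (R : realType) (F : finType) (U : choiceType)
    (X : metricType R) (posF : F -> X) (posU : U -> X) (f : F -> R)
    (d_gt0 : forall (i : F) (j : U), 0 < mdist (posF i) (posU j))
    (f_ge0 : forall i : F, 0 <= f i)
    (us : seq (update U)) (D : {fset U}) (S : clustering F U) :
  let d := fun (i : F) (j : U) => mdist (posF i) (posU j) in
  run d f us (D, S) -> is_clustering D S /\ nice d f D S.
Proof.
move=> d /(invariant_run d_gt0 f_ge0)[/= inv i4 i1]; split.
  exact: invariant_is_clustering inv.
by split=> //; [exact: invariant_I2 inv | exact: invariant_I3 inv].
Qed.
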